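(* Assume $\kappa_\psi^2 > \kappa_\varphi^1 > \kappa_\psi^1 > \kappa_\varphi^2$. For the MRD-SU-based trip scheduling model $$\max_{s}\ \bigl(\mathrm{UT}(T)+\mathrm{UAE}(s,T)+\mathrm{UAL}(s,T)\bigr)\quad\text{subject to } s\in[\mathrm{EDT},\mathrm{LDT}],$$ the optimal departure time $s^*$ (the maximizer) satisfies $s^*=\mathrm{PAT}-T$ for every travel time $T$; in particular $s^*$ becomes strictly earlier (is strictly decreasing in $T$) as the congestion becomes worse, i.e. as $T$ increases.
   Context: A single traveler uses a network with one route connecting a single origin-destination pair. The real variable $s$ is the departure time and $T\ge 0$ is the travel time on the route (the congestion level), so the arrival time is $s+T$. The real numbers $\mathrm{PAE}$ (preferred earliest-arrival time), $\mathrm{PAT}$ (preferred arrival time) and $\mathrm{PAL}$ (preferred latest-arrival time) are fixed reference points with $\mathrm{PAE}<\mathrm{PAT}<\mathrm{PAL}$. $\mathrm{EDT}$ is the earliest departure time, and $\mathrm{LDT}=\mathrm{PAL}-T^{\inf}$ is the latest departure time, where $T^{\inf}\le T$ is the infimum of the travel time on the route. The parameters $\kappa_\varphi^1,\kappa_\varphi^2,\kappa_T,\kappa_\rho^1,\kappa_\rho^2,\kappa_\psi^1,\kappa_\psi^2$ are positive reals with $\kappa_\varphi^1/\kappa_\varphi^2\ge 1$, $\kappa_\rho^1/\kappa_\rho^2\ge 1$, $\kappa_\psi^2/\kappa_\psi^1\ge 1$ and $\kappa_\rho^2\le\kappa_\psi^1$ ($\kappa_\varphi^1,\kappa_\varphi^2$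 are departure-utility parameters which do not enter the MRD-SU objective); $\Delta\le 0$ is a real constant. The utility components are: Travel-time utility: $\mathrm{UT}(T)=-\kappa_T T$. Early-arrival utility: $\mathrm{UAE}(s,T)=-\kappa_\rho^1(\mathrm{PAE}-s-T)$ if $s+T\le\mathrm{PAE}$; $\mathrm{UAE}(s,T)=\kappa_\rho^2(s+T-\mathrm{PAE})$ if $\mathrm{PAE}<s+T\le\mathrm{PAT}$; and $\mathrm{UAE}(s,T)=0$ otherwise. Late-arrival utility: $\mathrm{UAL}(s,T)=\kappa_\psi^1(\mathrm{PAL}-s-T)$ if $\mathrm{PAT}<s+T\le\mathrm{PAL}$; $\mathrm{UAL}(s,T)=-\kappa_\psi^2(s+T-\mathrm{PAL})+\Delta$ if $s+T>\mathrm{PAL}$; and $\mathrm{UAL}(s,T)=0$ otherwise. MRD-SU (departure-utility-excluded multi-reference-dependent scheduling utility) is the gross utility $\mathrm{UT}+\mathrm{UAE}+\mathrm{UAL}$.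
   Formalization: Assumes PAT−T is feasible (EDT ≤ PAT−T); a maximizer is claimed to exist only if κ_ψ¹(PAL−PAT) ≤ κ_ρ²(PAT−PAE), as otherwise the supremum is not attained; any maximizer, and always the limit of maximizing sequences, equals PAT−T. *)

(* Defs.v *)
From Stdlib Require Import Reals.
From Coquelicot Require Import Coquelicot.
Local Open Scope R_scope.

Definition UT (kT T : R) : R := - kT * T.

Definition UAE (PAE PAT krho1 krho2 s T : R) : R :=
  if Rle_dec (s + T) PAE then - krho1 * (PAE - s - T)
  else if Rle_dec (s + T) PAT then krho2 * (s + T - PAE)
  else 0.

Definition UAL (PAT PAL kpsi1 kpsi2 Delta s T : R) : R :=
  if Rle_dec (s + T) PAT then 0
  else if Rle_dec (s + T) PAL then kpsi1 * (PAL - s - T)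
  else - kpsi2 * (s + T - PAL) + Delta.

Definition MRDSU (PAE PAT PAL kT krho1 krho2 kpsi1 kpsi2 Delta T s : R) : R :=
  UT kT T + UAE PAE PAT krho1 krho2 s T + UAL PAT PAL kpsi1 kpsi2 Delta s T.

Definition LDT (PAL Tinf : R) : R := PAL - Tinf.

Definition is_maximizer (a b : R) (f : R -> R) (s : R) : Prop :=
  a <= s <= b /\ forall x : R, a <= x <= b -> f x <= f s.

Definition maximizing_seq (a b : R) (f : R -> R) (u : nat -> R) : Prop :=
  (forall n : nat, a <= u n <= b) /\
  exists M : R, is_lub (fun y => exists x : R, a <= x <= b /\ y = f x) M
                /\ Un_cv (fun n => f (u n)) M.

(* MRDSU jumps at the arrival time PAT, from krho2 * (PAT - PAE) to the right
   limit kpsi1 * (PAL - PAT) (up to the common term UT).  When the jump is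
   upwards the supremum is only approached, as s decreases to PAT - T, and is
   not attained; a limit maximizer is a point at which the supremum is
   approached.  Every maximizer is one (constant sequence). *)
Definition is_limit_maximizer (a b : R) (f : R -> R) (s : R) : Prop :=
  exists u : nat -> R, maximizing_seq a b f u /\ Un_cv u s.

(* Main.v *)
(** Write [p = PAT - T] and let [M] be the larger of the value of the utility at
    [p] and its right limit there.  The utility has a sharp peak at [p]: the
    slope conditions give [U s <= M - krho2 * |s - p|] for every [s].  As [M] is
    approached along points tending to [p] from the right (or at [p] itself), [M]
    is the supremum, every maximizing sequence tends to [p], and the supremum is
    attained, necessarily at [p], exactly when [U p = M]. *)

Require Import Defs.
From Stdlib Require Import Reals Lra Lia.
From Coquelicot Require Import Coquelicot.
Local Open Scope R_scope.

(** [M] is kept apart from [f p], since [f] may jump at [p] and only tend to [M] there. The bound is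
    global; only the approaching sequence is confined to [[a, b]]. *)
Definition sharp_peak (a b : R) (f : R -> R) (k p M : R) : Prop :=
  (forall x : R, f x <= M - k * Rabs (x - p)) /\
  exists u : nat -> R,
    (forall n, a <= u n <= b) /\ Un_cv u p /\ Un_cv (fun n => f (u n)) M.

Lemma sharp_peak_lub (a b : R) (f : R -> R) (k p M : R) :
  0 < k -> sharp_peak a b f k p M ->
  is_lub (fun y => exists x : R, a <= x <= b /\ y = f x) M.
Proof.
  intros Hk [Hf [u [Hu [_ HM]]]].
  split.
  - intros y [x [_ ->]].
    specialize (Hf x); pose proof (Rabs_pos (x - p)); nra.
  - intros B HB.
    apply is_lim_seq_Reals in HM.
    apply (is_lim_seq_le (fun n => f (u n)) (fun _ => B) M B);
      [ | exact HM | apply is_lim_seq_const].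
    intros n; apply HB; exists (u n); auto.
Qed.

(** A maximizer attains the supremum, so [M <= f s <= M - k * |s - p|], which leaves no room for [s]
    to differ from [p]. *)
Lemma sharp_peak_maximizer (a b : R) (f : R -> R) (k p M s : R) :
  0 < k -> sharp_peak a b f k p M -> is_maximizer a b f s -> s = p /\ f p = M.
Proof.
  intros Hk HP [Hs Hmax].
  destruct (sharp_peak_lub _ _ _ _ _ _ Hk HP) as [_ Hleast].
  assert (HM : M <= f s) by (apply Hleast; intros y [x [Hx ->]]; auto).
  destruct HP as [Hf _].
  pose proof (Hf s) as Hfs; pose proof (Rabs_pos (s - p)).
  assert (H0 : s - p = 0).
  { destruct (Req_dec (s - p) 0) as [E | E]; [exact E | ].
    apply Rabs_pos_lt in E; nra. }
  assert (s = p) by lra; subst s.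
  split; [reflexivity | nra].
Qed.

Lemma sharp_peak_limit_maximizer (a b : R) (f : R -> R) (k p M s : R) :
  0 < k -> sharp_peak a b f k p M -> (is_limit_maximizer a b f s <-> s = p).
Proof.
  intros Hk HP.
  pose proof (sharp_peak_lub _ _ _ _ _ _ Hk HP) as HlubM.
  destruct HP as [Hf [w [Hw [Hwp HwM]]]].
  split.
  - intros [u [[Hu [M' [HlubM' HM']]] Hus]].
    rewrite (is_lub_u _ _ _ HlubM' HlubM) in HM'.
    apply (UL_sequence u); [exact Hus | ].
    intros e He.
    (* The peak bound gives [k * |u n - p| <= M - f (u n)], so values within [k * e] of [M] force
       points within [e] of [p]. *)
    destruct (HM' (k * e)) as [N HN]; [nra | ].
    exists N; intros n Hn.
    specialize (HN n Hn); specialize (Hf (u n)).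
    unfold Rdist in *; apply Rabs_def2 in HN; nra.
  - intros ->; exists w; split; [split | ]; [exact Hw | | exact Hwp].
    exists M; split; assumption.
Qed.

Lemma MRDSU_at_PAT (PAE PAT PAL kT krho1 krho2 kpsi1 kpsi2 Delta T : R) :
  PAE < PAT ->
  MRDSU PAE PAT PAL kT krho1 krho2 kpsi1 kpsi2 Delta T (PAT - T)
  = - kT * T + krho2 * (PAT - PAE).
Proof.
  intros H; unfold MRDSU, UT, UAE, UAL.
  repeat destruct Rle_dec; lra.
Qed.

(** In [s] the utility has slopes [krho1], [krho2] before the arrival time [PAT] and [-kpsi1],
    [-kpsi2] after it, all at least [krho2] in size. It is continuous at [PAE], and the jump [Delta]
    at [PAL] is not upwards. The left side descends from the value at [PAT], the right side from the
    right limit. *)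
Lemma MRDSU_sharp_bound (PAE PAT PAL kT krho1 krho2 kpsi1 kpsi2 Delta T s : R) :
  PAE < PAT -> PAT < PAL -> krho2 <= krho1 -> krho2 <= kpsi1 ->
  kpsi1 <= kpsi2 -> Delta <= 0 ->
  MRDSU PAE PAT PAL kT krho1 krho2 kpsi1 kpsi2 Delta T s
  <= - kT * T + Rmax (krho2 * (PAT - PAE)) (kpsi1 * (PAL - PAT))
     - krho2 * Rabs (s - (PAT - T)).
Proof.
  intros H1 H2 H3 H4 H5 H6.
  pose proof (Rmax_l (krho2 * (PAT - PAE)) (kpsi1 * (PAL - PAT))).
  pose proof (Rmax_r (krho2 * (PAT - PAE)) (kpsi1 * (PAL - PAT))).
  unfold MRDSU, UT, UAE, UAL.
  destruct (Rle_dec (s + T) PAT) as [Hs | Hs].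
  - rewrite Rabs_left1 by lra.
    destruct (Rle_dec (s + T) PAE); nra.
  - rewrite Rabs_right by lra.
    destruct (Rle_dec (s + T) PAE); [lra | ].
    destruct (Rle_dec (s + T) PAL); nra.
Qed.

(** The sign of [d] is free: the lemma serves both for the departure times and for their
    utilities. *)
Lemma is_lim_seq_right_approach (c d : R) :
  is_lim_seq (fun n => c + d * / INR (S n)) c.
Proof.
  replace (Finite c) with (Finite (c + d * 0)) by (f_equal; ring).
  apply is_lim_seq_plus'; [apply is_lim_seq_const | ].
  apply (is_lim_seq_scal_l _ d 0).
  apply (is_lim_seq_incr_1 (fun n => / INR n)).
  apply (is_lim_seq_inv _ p_infty); [apply is_lim_seq_INR | discriminate].
Qed.

Lemma MRDSU_sharp_peak
  (a b PAE PAT PAL kT krho1 krho2 kpsi1 kpsi2 Delta T : R) :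
  PAE < PAT -> PAT < PAL -> krho2 <= krho1 -> krho2 <= kpsi1 ->
  kpsi1 <= kpsi2 -> Delta <= 0 -> a <= PAT - T -> PAL - T <= b ->
  sharp_peak a b (MRDSU PAE PAT PAL kT krho1 krho2 kpsi1 kpsi2 Delta T)
    krho2 (PAT - T)
    (- kT * T + Rmax (krho2 * (PAT - PAE)) (kpsi1 * (PAL - PAT))).
Proof.
  intros H1 H2 H3 H4 H5 H6 Ha Hb.
  split; [intros s; now apply MRDSU_sharp_bound | ].
  destruct (Rle_dec (kpsi1 * (PAL - PAT)) (krho2 * (PAT - PAE))) as [HAB | HAB].
  - exists (fun _ => PAT - T).
    rewrite Rmax_left by assumption.
    split; [intros _; lra | ].
    split; apply is_lim_seq_Reals; [apply is_lim_seq_const | ].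
    rewrite MRDSU_at_PAT by assumption.
    apply is_lim_seq_const.
  - rewrite Rmax_right by lra.
    (* Upward jump: positive steps put the arrival strictly after [PAT], and the bound [PAL - PAT],
       reached at [n = 0], keeps it on the [kpsi1] branch and the departure within [[a, b]]. *)
    assert (Hstep : forall n,
      0 < (PAL - PAT) * / INR (S n) <= PAL - PAT).
    { intros n.
      pose proof (lt_0_INR (S n) ltac:(lia)) as Hpos.
      assert (1 <= INR (S n)) by (apply (le_INR 1); lia).
      split; [apply Rmult_lt_0_compat; [lra | now apply Rinv_0_lt_compat] | ].
      assert (/ INR (S n) <= 1) by (rewrite <- Rinv_1; apply Rinv_le_contravar; lra).
      nra. }
    exists (fun n => PAT - T + (PAL - PAT) * / INR (S n)).
    split; [intros n; specialize (Hstep n); lra | ].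
    split; apply is_lim_seq_Reals; [apply is_lim_seq_right_approach | ].
    (* On this branch the utility is exactly the right limit minus [kpsi1] times the step. *)
    eapply is_lim_seq_ext;
      [ | apply (is_lim_seq_right_approach _ (- kpsi1 * (PAL - PAT)))].
    intros n; specialize (Hstep n).
    unfold MRDSU, UT, UAE, UAL.
    repeat destruct Rle_dec; lra.
Qed.

(** [travel_time] is the set of travel times of the route, and [EDT <= PAT - T] makes arrival at
    [PAT] possible. As a maximizer can fail to exist, the claims are also made for limit maximizers,
    which always exist here. *)
Theorem proposition3
  (PAE PAT PAL EDT Tinf Delta : R)
  (kphi1 kphi2 kT krho1 krho2 kpsi1 kpsi2 : R)
  (travel_time : R -> Prop)
  (HPAE : PAE < PAT) (HPAL : PAT < PAL)
  (Htt : forall T : R, travel_time T -> 0 <= T)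
  (HTinf : is_glb_Rbar travel_time (Finite Tinf))
  (Hphi1 : 0 < kphi1) (Hphi2 : 0 < kphi2) (HkT : 0 < kT)
  (Hrho1 : 0 < krho1) (Hrho2 : 0 < krho2)
  (Hpsi1 : 0 < kpsi1) (Hpsi2 : 0 < kpsi2)
  (Hphi : 1 <= kphi1 / kphi2) (Hrho : 1 <= krho1 / krho2)
  (Hpsi : 1 <= kpsi2 / kpsi1) (Hrhopsi : krho2 <= kpsi1)
  (HDelta : Delta <= 0)
  (Hord1 : kphi1 < kpsi2) (Hord2 : kpsi1 < kphi1) (Hord3 : kphi2 < kpsi1) :
  let U := MRDSU PAE PAT PAL kT krho1 krho2 kpsi1 kpsi2 Delta in
  let optimal T s := is_maximizer EDT (LDT PAL Tinf) (U T) s in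
  let limit_optimal T s := is_limit_maximizer EDT (LDT PAL Tinf) (U T) s in
  (forall T : R, travel_time T -> EDT <= PAT - T ->
     (forall s : R, optimal T s -> s = PAT - T) /\
     ((exists s : R, optimal T s) <->
        kpsi1 * (PAL - PAT) <= krho2 * (PAT - PAE)) /\
     (forall s : R, limit_optimal T s <-> s = PAT - T))
  /\
  (forall T1 T2 s1 s2 : R,
     travel_time T1 -> travel_time T2 ->
     EDT <= PAT - T1 -> EDT <= PAT - T2 -> T1 < T2 ->
     (optimal T1 s1 -> optimal T2 s2 -> s2 < s1) /\
     (limit_optimal T1 s1 -> limit_optimal T2 s2 -> s2 < s1)).
Proof.
  intros U optimal limit_optimal.
  assert (Hrho' : krho2 <= krho1) by
    (apply (Rle_div_r 1 krho1 krho2) in Hrho; lra).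
  assert (Hpsi' : kpsi1 <= kpsi2) by lra.
  assert (Hpeak : forall T, travel_time T -> EDT <= PAT - T ->
    sharp_peak EDT (LDT PAL Tinf) (U T) krho2 (PAT - T)
      (- kT * T + Rmax (krho2 * (PAT - PAE)) (kpsi1 * (PAL - PAT)))).
  { intros T HT HE.
    apply MRDSU_sharp_peak; try assumption.
    (* [Tinf <= T] gives [PAL - T <= LDT PAL Tinf], the room needed to the right of the peak. *)
    pose proof (proj1 HTinf T HT) as HTT; simpl in HTT.
    unfold LDT; lra. }
  assert (Hmain : forall T, travel_time T -> EDT <= PAT - T ->
     (forall s : R, optimal T s -> s = PAT - T) /\
     ((exists s : R, optimal T s) <->
        kpsi1 * (PAL - PAT) <= krho2 * (PAT - PAE)) /\
     (forall s : R, limit_optimal T s <-> s = PAT - T)).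
  { intros T HT HE.
    specialize (Hpeak T HT HE).
    split; [ | split].
    - intros s Hs.
      exact (proj1 (sharp_peak_maximizer _ _ _ _ _ _ _ Hrho2 Hpeak Hs)).
    - split.
      + intros [s Hs].
        destruct (sharp_peak_maximizer _ _ _ _ _ _ _ Hrho2 Hpeak Hs) as [_ HM].
        unfold U in HM; rewrite MRDSU_at_PAT in HM by assumption.
        pose proof (Rmax_r (krho2 * (PAT - PAE)) (kpsi1 * (PAL - PAT))); lra.
      + intros HAB; exists (PAT - T); split.
        * pose proof (proj1 HTinf T HT) as HTT; simpl in HTT.
          unfold LDT; lra.
        * intros x Hx.
          (* The supremum bounds [U T x], and [HAB] makes it equal to the value at [PAT - T]. *)
          apply (Rle_trans _ _ _
                   (proj1 (sharp_peak_lub _ _ _ _ _ _ Hrho2 Hpeak) _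
                      (ex_intro _ x (conj Hx eq_refl)))).
          unfold U; rewrite MRDSU_at_PAT, Rmax_left by assumption.
          apply Rle_refl.
    - intros s; exact (sharp_peak_limit_maximizer _ _ _ _ _ _ s Hrho2 Hpeak). }
  split; [exact Hmain | ].
  intros T1 T2 s1 s2 HT1 HT2 HE1 HE2 Hlt.
  destruct (Hmain T1 HT1 HE1) as [Ho1 [_ Hl1]].
  destruct (Hmain T2 HT2 HE2) as [Ho2 [_ Hl2]].
  split.
  - intros H1 H2; apply Ho1 in H1; apply Ho2 in H2; lra.
  - intros H1 H2; apply Hl1 in H1; apply Hl2 in H2; lra.
Qed.
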